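(* Let $G$ be the group with presentation $$\langle a,b,c,t \mid ac=ca,\ bc=cb,\ act=tac,\ bct=tbc\rangle$$ and let $S_2=\{a,b,c,t\}$. Then the pair $(G,S_2)$ does not satisfy the loop shortening property.
   Context: For a group $G$ with finite generating set $S$, the Cayley graph $\Gamma(G,S)$ has vertex set $G$ and an edge joining $g$ and $gs$ for each $g\in G$, $s\in S$; $d$ denotes the path metric, so $d(g_1,g_2)$ is the length of a shortest word over $S\cup S^{-1}$ representing $g_1^{-1}g_2$. A loop is a sequence of vertices $v_0,v_1,\ldots,v_n$ with $v_n=v_0$ in which each vertex is adjacent to the previous one; its length is $n$. The pair $(G,S)$ has the (synchronous) loop shortening property (LSP) if there is a constant $k$ such that for any loop $v_0,v_1,\ldots,v_n$ in $\Gamma(G,S)$ with $v_0=v_n$ and $n\geq 1$, there is a shorter loop $u_0,u_1,\ldots,u_m$ (that is, $m<n$) with $u_m=u_0$ such that $d(u_j,v_j)<k$ for each $0\leq j\leq m$, and $d(u_m,v_j)<k$ for $m\leq j\leq n$. *)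

(* Defs.v *)
From HB Require Import structures.
From mathcomp Require Import all_boot boolp.

Set Implicit Arguments.
Unset Strict Implicit.
Unset Printing Implicit Defensive.

Local Open Scope group_scope.

(* The letter (x, true) stands for x and (x, false) for its inverse. *)
Definition letter (X : Type) : Type := (X * bool)%type.
Definition word (X : Type) : Type := seq (letter X).


Definition flip (X : Type) (l : letter X) : letter X := (l.1, ~~ l.2).
Definition winv (X : Type) (w : word X) : word X := rev (map (@flip X) w).

Section Presentation.
Variables (X : choiceType) (R : seq (word X * word X)).

(* The congruence on words generated by free cancellation and by the
   relations r.1 = r.2 for r in R. *)
Inductive weq : word X -> word X -> Prop :=
| weq_refl w : weq w w
| weq_sym w1 w2 : weq w1 w2 -> weq w2 w1
| weq_trans w2 w1 w3 : weq w1 w2 -> weq w2 w3 -> weq w1 w3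
| weq_cat w1 w1' w2 w2' :
    weq w1 w1' -> weq w2 w2' -> weq (w1 ++ w2) (w1' ++ w2')
| weq_cancel l : weq [:: l; flip l] [::]
| weq_rel r : r \in R -> weq r.1 r.2.

Definition weqb : rel (word X) := fun w1 w2 => `[< weq w1 w2 >].

Lemma weqb_equiv : equiv_class_of weqb.
Proof.
split=> [w|w1 w2|w2 w1 w3]; first exact/asboolP/weq_refl.
  by apply/asboolP/asboolP => /weq_sym.
by move=> /asboolP w12 /asboolP w23; apply/asboolP/(weq_trans w12).
Qed.

Canonical weqb_equiv_rel := EquivRelPack weqb_equiv.

Local Open Scope quotient_scope.

Definition pres := {eq_quot weqb}.
HB.instance Definition _ := Choice.on pres.
HB.instance Definition _ := EqQuotient.on pres.

Definition pres_class (w : word X) : pres := \pi_pres w.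
Definition pres_gen (x : X) : pres := pres_class [:: (x, true)].

Lemma pres_classP w1 w2 : pres_class w1 = pres_class w2 <-> weq w1 w2.
Proof. by split=> [/eqmodP/asboolP //|h]; apply/eqmodP/asboolP. Qed.

Lemma weq_repr w : weq (repr (pres_class w)) w.
Proof. by apply/pres_classP; rewrite /pres_class reprK. Qed.

Lemma pres_ind (P : pres -> Prop) :
  (forall w, P (pres_class w)) -> forall g, P g.
Proof. by move=> h g; rewrite -[g]reprK; apply: h. Qed.

Lemma flipK : involutive (@flip X).
Proof. by case=> x b; rewrite /flip /= negbK. Qed.

Lemma winvK : involutive (@winv X).
Proof. by move=> w; rewrite /winv map_rev revK mapK//; exact: flipK. Qed.

Lemma weq_winvr w : weq (w ++ winv w) [::].
Proof.
elim: w => [|l w IH]; first exact: weq_refl.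
rewrite /winv /= rev_cons -cats1 -cat1s catA -(cat1s l) -catA.
apply: weq_trans (weq_cancel l).
rewrite -[[:: l; flip l]]/([:: l] ++ ([::] ++ [:: flip l])).
apply: weq_cat; first exact: weq_refl.
by rewrite catA; apply: weq_cat => //; exact: weq_refl.
Qed.

Lemma weq_winvl w : weq (winv w ++ w) [::].
Proof. by have := weq_winvr (winv w); rewrite winvK. Qed.

Lemma weq_winv w1 w2 : weq w1 w2 -> weq (winv w1) (winv w2).
Proof.
move=> w12; apply: (@weq_trans (winv w1 ++ (w2 ++ winv w2))).
  rewrite -[X in weq X _]cats0; apply: weq_cat; first exact: weq_refl.
  exact/weq_sym/weq_winvr.
rewrite catA -[X in weq _ X]cat0s; apply: weq_cat; last exact: weq_refl.
apply: weq_trans (weq_winvl w1); apply: weq_cat; first exact: weq_refl.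
exact: weq_sym.
Qed.

Definition pres_one : pres := pres_class [::].
Definition pres_mul (g h : pres) : pres := pres_class (repr g ++ repr h).
Definition pres_inv (g : pres) : pres := pres_class (winv (repr g)).

Lemma pres_mulE w1 w2 :
  pres_mul (pres_class w1) (pres_class w2) = pres_class (w1 ++ w2).
Proof. by apply/pres_classP/weq_cat; exact: weq_repr. Qed.

Lemma pres_invE w : pres_inv (pres_class w) = pres_class (winv w).
Proof. exact/pres_classP/weq_winv/weq_repr. Qed.

Lemma pres_mulA : associative pres_mul.
Proof.
elim/pres_ind=> w1; elim/pres_ind=> w2; elim/pres_ind=> w3.
by rewrite !pres_mulE catA.
Qed.

Lemma pres_mul1 : left_id pres_one pres_mul.
Proof. by elim/pres_ind=> w; rewrite pres_mulE. Qed.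

Lemma pres_mulr1 : right_id pres_one pres_mul.
Proof. by elim/pres_ind=> w; rewrite pres_mulE cats0. Qed.

Lemma pres_mulV : left_inverse pres_one pres_inv pres_mul.
Proof.
elim/pres_ind=> w; rewrite pres_invE pres_mulE.
exact/pres_classP/weq_winvl.
Qed.

Lemma pres_mulVr : right_inverse pres_one pres_inv pres_mul.
Proof.
elim/pres_ind=> w; rewrite pres_invE pres_mulE.
exact/pres_classP/weq_winvr.
Qed.

HB.instance Definition _ := isGroup.Build pres
  pres_mulA pres_mul1 pres_mulr1 pres_mulV pres_mulVr.

Lemma pres_class_cat w1 w2 :
  pres_class (w1 ++ w2) = pres_class w1 * pres_class w2.
Proof. by rewrite -pres_mulE. Qed.

Lemma pres_class_winv w : pres_class (winv w) = (pres_class w)^-1.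
Proof. by rewrite -pres_invE. Qed.

Lemma pres_class1 : pres_class [::] = 1.
Proof. by []. Qed.

Lemma pres_class_rel r : r \in R -> pres_class r.1 = pres_class r.2.
Proof. by move=> Rr; apply/pres_classP/weq_rel. Qed.

End Presentation.

Definition letter_eval (X : Type) (H : groupType) (f : X -> H) (l : letter X)
  : H := if l.2 then f l.1 else (f l.1)^-1.
Definition word_eval (X : Type) (H : groupType) (f : X -> H) (w : word X)
  : H := \prod_(l <- w) letter_eval f l.

Lemma pres_class_eval (X : choiceType) (R : seq (word X * word X)) w :
  pres_class R w = word_eval (pres_gen R) w.
Proof.
rewrite /word_eval; elim: w => [|[x b] w IH]; first by rewrite big_nil.
rewrite big_cons -IH -cat1s pres_class_cat /letter_eval; case: b => //=.
by rewrite /pres_gen -pres_class_winv.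
Qed.

Lemma pres_universal (X : choiceType) (R : seq (word X * word X)) (H : groupType)
    (f : X -> H) :
  (forall r, r \in R -> word_eval f r.1 = word_eval f r.2) ->
  exists phi : pres R -> H,
    {morph phi : g h / g * h} /\ forall x, phi (pres_gen R x) = f x.
Proof.
move=> fR; have fE w1 w2 : weq R w1 w2 -> word_eval f w1 = word_eval f w2.
  elim=> {w1 w2} [//|//|w2 w1 w3 _ -> _ //|w1 w1' w2 w2' _ e1 _ e2|l|//].
    by rewrite /word_eval !big_cat /= -!/(word_eval f _) e1 e2.
  rewrite /word_eval !big_cons big_nil mulg1 /letter_eval /=.
  by case: l.2; rewrite /= ?mulgV ?mulVg.
have eC w : word_eval f (repr (pres_class R w)) = word_eval f w.
  exact/fE/weq_repr.
exists (fun g => word_eval f (repr g)); split=> [|x]; last first.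
  by rewrite eC /word_eval big_seq1.
elim/pres_ind=> w1; elim/pres_ind=> w2.
by rewrite -pres_class_cat !eC /word_eval big_cat.
Qed.

Definition word_over (G : groupType) (S : seq G) (w : seq G) : Prop :=
  forall x, x \in w -> x \in S \/ x^-1 \in S.

Definition represented (G : groupType) (S : seq G) (n : nat) (g : G) : Prop :=
  exists w : seq G, [/\ word_over S w, size w = n & \prod_(x <- w) x = g].

Definition generates (G : groupType) (S : seq G) : Prop :=
  forall g : G, exists n, represented S n g.

Section Cayley.
Variables (G : groupType) (S : seq G) (genS : generates S).

Definition adjacent (g h : G) : Prop :=
  exists2 s, s \in S & h = g * s \/ g = h * s.

Lemma word_length_subproof (g : G) : exists n, `[< represented S n g >].
Proof. by have [n gn] := genS g; exists n; apply/asboolP. Qed.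

Definition word_length (g : G) : nat := ex_minn (word_length_subproof g).

Definition dist (g h : G) : nat := word_length (g^-1 * h).

(* A loop of length n is v 0, ..., v n; the values of v beyond n are
   irrelevant. *)
Definition loop (n : nat) (v : nat -> G) : Prop :=
  v n = v 0 /\ forall j, j < n -> adjacent (v j) (v j.+1).

Definition loop_shortening : Prop :=
  exists k : nat, forall (n : nat) (v : nat -> G), 0 < n -> loop n v ->
  exists (m : nat) (u : nat -> G),
    [/\ m < n,
        loop m u,
        forall j, j <= m -> dist (u j) (v j) < k
      & forall j, m <= j <= n -> dist (u m) (v j) < k].

End Cayley.

Inductive gens := Ga | Gb | Gc | Gt.

Definition gens_code (x : gens) : 'I_4 :=
  match x with Ga => inord 0 | Gb => inord 1 | Gc => inord 2 | Gt => inord 3 end.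
Definition gens_decode (i : 'I_4) : gens :=
  match val i with 0 => Ga | 1 => Gb | 2 => Gc | _ => Gt end.
Lemma gens_codeK : cancel gens_code gens_decode.
Proof. by case; rewrite /gens_decode /= inordK. Qed.

HB.instance Definition _ := Finite.copy gens (can_type gens_codeK).

Definition pos (s : seq gens) : word gens := [seq (x, true) | x <- s].

Definition relations : seq (word gens * word gens) :=
  [:: (pos [:: Ga; Gc], pos [:: Gc; Ga]);
      (pos [:: Gb; Gc], pos [:: Gc; Gb]);
      (pos [:: Ga; Gc; Gt], pos [:: Gt; Ga; Gc]);
      (pos [:: Gb; Gc; Gt], pos [:: Gt; Gb; Gc])].

Definition G : groupType := pres relations.

Definition S2 : seq G :=
  [:: pres_gen relations Ga; pres_gen relations Gb;
      pres_gen relations Gc; pres_gen relations Gt].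

Lemma S2_generates : generates S2.
Proof.
elim/pres_ind=> w; exists (size w).
exists [seq letter_eval (pres_gen relations) l | l <- w].
rewrite size_map big_map; split=> //; last by rewrite pres_class_eval.
move=> _ /mapP[[x b] _ ->]; rewrite /letter_eval /=.
have xS : pres_gen relations x \in S2.
  by rewrite !inE; case: x; rewrite eqxx ?orbT.
by case: b; [left|right; rewrite invgK].
Qed.

(* Main.v *)
From mathcomp Require Import all_boot all_algebra boolp zify.
Require Import Defs.

Set Implicit Arguments.
Unset Strict Implicit.
Unset Printing Implicit Defensive.

Local Open Scope group_scope.

(** The elements x = ac and y = bc commute with both c and t, so the group is
    the direct product of the free groups F(x, y) and F(c, t), in which
    a = (x, c^-1) and b = (y, c^-1).  A vertex is thus a pair of vertices of two
    trees.  Edges labelled t move only in the second tree, edges labelled c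
    only along the c-lines of the second tree, and edges labelled a or b move
    in both trees at once.

    For each k a loop of length 16k + 6 is exhibited that no shorter loop
    follows at distance less than k.  With x, y, c, t as above and n = 2k it is
    the cyclic word
      t a^n . t b^-n . a^n . t^-1 b^-n . t^-1 b^n . t a^-n . b^n . t^-1 a^-n,
    read from the middle of the first a^n (lemma [zigzag_closed] shows that it
    closes up).  Cut it in the middle of each syllable: this gives eight
    windows, which are peaks a^k t^e b^-k, valleys b^-k a^k or dips b^-k t^e b^k
    (up to exchanging a and b).  At the cuts, the exponent sum A in x and y and
    the exponent sum C in c both vanish.

    In a tree where the window does not backtrack, its two ends lie on different
    sides of its middle vertex or t-edge, at distance at least k from it.  Hence
    a loop u following the given one within less than k is on different sides as
    well, and has to pass through that vertex or edge in between:
    - in a peak, u visits a vertex with A = k, and crosses an edge labelled t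
      whose ends have C = -k, in an unknown order ([window_peak]);
    - in a valley, u visits a vertex with A = -k ([window_valley]);
    - in a dip, u crosses an edge labelled t whose ends have C = k
      ([window_dip]).

    From here on only exponent sums matter.  An edge labelled t changes neither
    A nor A + C, an edge labelled a or b changes only A, an edge labelled c only
    A + C, each by one.  So a stretch of u is at least as long as
    |change of A| + |change of A + C| ([walk_length]).  Whatever the order of
    the two events in a peak and the unknown values of A at the t-edges, the
    passage from a valley to a dip through a peak takes at least 4k steps
    besides the t-edge of the peak ([valley_to_dip], [dip_to_valley]).  The loop
    u makes four such passages and crosses the two t-edges of the dips, so it
    has length at least 4(4k + 1) + 2 = 16k + 6. *)

(** * Right action of words on reduced words *)

(** A reduced word is stored with its last letter at the head, so that right
    multiplication by a letter acts on the head.  The letters Ga and Gb of a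
    stack stand for x and y in the first tree. *)
Notation stack := (word gens).

Definition reduced (s : stack) : bool := sorted (fun l h => h != flip l) s.

Definition push (l : letter gens) (s : stack) : stack :=
  if s is h :: s' then if h == flip l then s' else l :: s else [:: l].

Lemma push_reduced l s : reduced s -> reduced (push l s).
Proof.
case: s => [//|h s] /=; case: eqP => [_|/eqP hl] hs; first exact: path_sorted hs.
by rewrite /= hl.
Qed.

Lemma pushK l s : reduced s -> push (flip l) (push l s) = s.
Proof.
case: s => [|h s] /=; first by rewrite flipK eqxx.
case: eqP => [->|_] /=; last by rewrite flipK eqxx.
case: s => [//|h' s] /=; rewrite !flipK => /andP[h'l _].
by rewrite (negbTE h'l).
Qed.

(** The map f sends each generator to a free generator or to the identity, the
    latter encoded by None; this is enough for the two projections below and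
    keeps each edge of the Cayley graph within one edge of a tree. *)
Definition image (f : gens -> option (letter gens)) (l : letter gens)
  : option (letter gens) :=
  if f l.1 is Some x then Some (if l.2 then x else flip x) else None.

Definition act f (s : stack) (l : letter gens) : stack :=
  if image f l is Some y then push y s else s.

Definition run f (s : stack) (w : word gens) : stack := foldl (act f) s w.

Lemma run_cat f s w1 w2 : run f s (w1 ++ w2) = run f (run f s w1) w2.
Proof. exact: foldl_cat. Qed.

Lemma act_reduced f s l : reduced s -> reduced (act f s l).
Proof. by rewrite /act; case: (image _ _) => // x; exact: push_reduced. Qed.

Lemma run_reduced f s w : reduced s -> reduced (run f s w).
Proof. by elim: w s => //= l w IH s /(act_reduced f l)/IH. Qed.

Lemma actK f s l : reduced s -> act f (act f s l) (flip l) = s.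
Proof.
rewrite /act /image /=; case: (f _) => // x rs; case: l.2 => /=; first exact: pushK.
by rewrite -[X in push X]flipK pushK.
Qed.

(** * The two tree coordinates *)

Definition left_coord (x : gens) : option (letter gens) :=
  match x with Ga | Gb => Some (x, true) | _ => None end.

Definition right_coord (x : gens) : option (letter gens) :=
  match x with
  | Ga | Gb => Some (Gc, false) | Gc | Gt => Some (x, true)
  end.

(** The index true selects the projection to F(x, y), false the one to
    F(c, t). *)
Definition coord (i : bool) := if i then left_coord else right_coord.

(** Each letter acts on reduced words by a permutation, which makes free
    cancellation harmless; the four relations then hold because the letters
    that ac and bc contribute to F(c, t) cancel. *)
Lemma run_weq i w1 w2 s :
  weq relations w1 w2 -> reduced s -> run (coord i) s w1 = run (coord i) s w2.
Proof.
move=> w12; elim: w12 s => {w1 w2}.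
- by [].
- by move=> w1 w2 _ IH s rs; rewrite IH.
- by move=> w2 w1 w3 _ IH1 _ IH2 s rs; rewrite IH1 ?IH2.
- move=> w1 w1' w2 w2' _ IH1 _ IH2 s rs.
  by rewrite !run_cat IH1 ?IH2 ?run_reduced.
- by move=> l s rs; rewrite /= actK.
have cK s : reduced s -> push (Gc, false) (push (Gc, true) s) = s by exact: pushK.
have CK s : reduced s -> push (Gc, true) (push (Gc, false) s) = s by exact: pushK.
move=> r; rewrite !inE => /or4P[] /eqP-> s rs; case: i => //=;
  by rewrite /act /image /= !(cK, CK) ?push_reduced.
Qed.

(** The coordinate of g in tree i, translated on the left by s: choosing s to be
    the inverse of a vertex moves that vertex to the root, the empty stack. *)
Definition place i (s : stack) (g : G) : stack := run (coord i) s (repr g).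

Lemma place_class i s w :
  reduced s -> place i s (pres_class relations w) = run (coord i) s w.
Proof. by move=> rs; apply: run_weq => //; exact: weq_repr. Qed.

Lemma place_reduced i s g : reduced s -> reduced (place i s g).
Proof. exact: run_reduced. Qed.

Lemma placeM i s g h :
  reduced s -> place i s (g * h) = place i (place i s g) h.
Proof.
move=> rs; rewrite -{1}[g]reprK -{1}[h]reprK -!/(pres_class _ _).
by rewrite -pres_class_cat place_class// run_cat.
Qed.

Lemma place1 i s : reduced s -> place i s 1 = s.
Proof. by move=> rs; rewrite -(pres_class1 relations) place_class. Qed.

Lemma place_gen i s g x :
  reduced s ->
  place i s (g * pres_gen relations x) = act (coord i) (place i s g) (x, true).
Proof. by move=> rs; rewrite placeM// place_class ?place_reduced. Qed.

(** * Separation in a tree *)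

Definition tree_step (s s' : stack) : Prop :=
  [\/ s' = s, exists l, s' = l :: s | exists l, s = l :: s'].

Lemma tree_step_sym s s' : tree_step s s' -> tree_step s' s.
Proof. by case; [constructor 1 | constructor 3 | constructor 2]. Qed.

Lemma act_tree_step f s l : tree_step s (act f s l).
Proof.
rewrite /act; case: (image _ _) => [y|]; last by constructor 1.
case: s => [|h s] /=; first by constructor 2; exists y.
by case: eqP => _; [constructor 3; exists h | constructor 2; exists y].
Qed.

Lemma adjacent_gen g h : adjacent S2 g h ->
  exists x, h = g * pres_gen relations x \/ g = h * pres_gen relations x.
Proof.
by case=> s; rewrite !inE => /or4P[] /eqP->; [exists Ga|exists Gb|exists Gc|exists Gt].
Qed.

Lemma adjacentMl z g h : adjacent S2 g h -> adjacent S2 (z * g) (z * h).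
Proof. by case=> s Ss [->|->]; exists s; rewrite ?mulgA //; [left|right]. Qed.

Lemma place_tree_step i s g h :
  reduced s -> adjacent S2 g h -> tree_step (place i s g) (place i s h).
Proof.
move=> rs /adjacent_gen[x [->|->]]; rewrite place_gen//; last apply: tree_step_sym;
  exact: act_tree_step.
Qed.

(** The first letter of a reduced word: it tells in which component of the tree
    minus its root the word lies. *)
Definition bottom (s : stack) : option (letter gens) := last None (map Some s).

Lemma tree_step_bottom s s' :
  tree_step s s' -> s != [::] -> s' != [::] -> bottom s = bottom s'.
Proof. by case=> [->|[l ->]|[l ->]] //; [case: s|case: s']. Qed.

Lemma tree_step_size s s' : tree_step s s' -> size s' <= (size s).+1.
Proof. by case=> [->|[l ->]|[l ->]] //=; rewrite ltnW. Qed.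

Definition across (l : letter gens) (s s' : stack) : Prop :=
  (s = [::] /\ s' = [:: l]) \/ (s = [:: l] /\ s' = [::]).

Lemma tree_step_across l s s' : tree_step s s' ->
  (bottom s == Some l) != (bottom s' == Some l) -> across l s s'.
Proof.
case=> [->|[x ->]|[x ->]]; first by rewrite eqxx.
  case: s => [|h s]; rewrite /bottom /= ?eqxx //.
  by case: (Some x =P Some l) => // -[->] _; left.
case: s' => [|h s']; rewrite /bottom /= ?eqxx //.
by case: (Some x =P Some l) => // -[->] _; right.
Qed.

(** The component can change only along an edge at the root, and entering or
    leaving the component of l uses the edge labelled l. *)
Lemma walk_across l (p : nat -> stack) i j :
  i <= j -> (forall r, tree_step (p r) (p r.+1)) ->
  (bottom (p i) == Some l) != (bottom (p j) == Some l) ->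
  exists2 r, i <= r < j & across l (p r) (p r.+1).
Proof.
move=> + pn; elim: j => [|j IH]; first by rewrite leqn0 => /eqP->; rewrite eqxx.
rewrite leq_eqVlt => /predU1P[->|]; first by rewrite eqxx.
rewrite ltnS => ij; case: (eqVneq (bottom (p i) == Some l) (bottom (p j) == Some l)).
  by move=> -> /(tree_step_across (pn j)) ac; exists j; rewrite ?ij ?leqnn.
move=> /(IH ij)[r /andP[ir rj] ac] _; exists r => //; by rewrite ir ltnW.
Qed.

(** A path shorter than the distance to the root stays in one component.  The
    bound on sizes is carried along to keep the induction going. *)
Lemma word_over_bottom i s g (w : seq G) : reduced s -> word_over S2 w ->
  size w < size (place i s (g * \prod_(x <- w) x)) ->
  bottom (place i s g) = bottom (place i s (g * \prod_(x <- w) x))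
  /\ size (place i s (g * \prod_(x <- w) x)) <= size (place i s g) + size w.
Proof.
move=> rs; elim: w g => [|x w IH] g wS; first by rewrite big_nil mulg1 addn0.
rewrite big_cons mulgA -[size (x :: w)]/((size w).+1) => sz.
have [|e le] := IH (g * x) _ (ltnW sz).
  by move=> y yw; apply: wS; rewrite inE yw orbT.
have gx : adjacent S2 g (g * x).
  have [Sx|Sx] := wS x (mem_head _ _); first by exists x => //; left.
  by exists x^-1 => //; right; rewrite mulgK.
have nb := place_tree_step i rs gx; have /tree_step_size sz1 := nb.
have szx := leq_trans sz le; split; last by apply: leq_trans le _; lia.
have gx1 : 1 < size (place i s (g * x)) by lia.
rewrite -e; apply: (tree_step_bottom nb); rewrite -size_eq0 -lt0n; last exact: ltnW.
by rewrite -ltnS (leq_trans gx1).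
Qed.

Lemma dist_bottom i s z g h k : reduced s -> dist S2_generates g h < k ->
  k <= size (place i s (z * h)) ->
  bottom (place i s (z * g)) = bottom (place i s (z * h)).
Proof.
rewrite /dist /word_length; case: ex_minnP => d /asboolP[w [wS <- pw]] _ rs wk kh.
have e : z * h = z * g * \prod_(x <- w) x by rewrite pw mulgA mulgK.
rewrite e in kh *.
by have [] := word_over_bottom rs wS (leq_trans wk kh).
Qed.


(** * Exponent sums and lengths of walks *)

(** Weighting all letters but t computes the exponent sum in x and y in the
    first tree, and the exponent sum in c in the second. *)
Definition weight (l : letter gens) : int :=
  match l.1 with Gt => 0%R | _ => if l.2 then 1%R else (-1)%R end.

Definition height (s : stack) : int := (\sum_(l <- s) weight l)%R.

Lemma height_push l s : height (push l s) = (weight l + height s)%R.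
Proof.
rewrite /height; case: s => [|h s] /=; first by rewrite big_cons.
case: eqP => [->|_]; rewrite !big_cons //.
have -> : weight (flip l) = (- weight l)%R by case: l => -[] [].
by lia.
Qed.

Lemma height_act f s l : height (act f s l) = (height s + height (act f [::] l))%R.
Proof.
rewrite /act; case: (image _ _) => [y|]; rewrite ?height_push /height big_nil; lia.
Qed.

Lemma height_run f s w : height (run f s w) = (height s + height (run f [::] w))%R.
Proof.
elim: w s => [|l w IH] s /=; first by rewrite /height big_nil; lia.
by rewrite IH height_act (IH (act f [::] l)); lia.
Qed.

Definition expo i (g : G) : int := height (place i [::] g).

Lemma height_place i s g : height (place i s g) = (height s + expo i g)%R.
Proof. exact: height_run. Qed.

Lemma expoM i g h : expo i (g * h) = (expo i g + expo i h)%R.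
Proof. by rewrite /expo placeM// height_place. Qed.

Lemma expo1 i : expo i 1 = 0%R.
Proof. by rewrite /expo place1 // /height big_nil. Qed.

Lemma expoV i g : expo i g^-1 = (- expo i g)%R.
Proof. by have := expoM i g g^-1; rewrite mulgV expo1; lia. Qed.

Lemma expo_class i w : expo i (pres_class relations w) = height (run (coord i) [::] w).
Proof. by rewrite /expo place_class. Qed.

Lemma expo_nseq i n l :
  height (run (coord i) [::] (nseq n l)) =
  (height (act (coord i) [::] l) *+ n)%R.
Proof.
elim: n => [|n IH]; first by rewrite /height /= big_nil.
by rewrite /= height_run IH GRing.mulrS.
Qed.

(** The net number of edges labelled c along a path from 1 to g: each edge
    labelled a or b moves the exponent of c opposite to the one in x and y. *)
Definition c_count (g : G) : int := (expo true g + expo false g)%R.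

Lemma expo_adjacent g h : adjacent S2 g h ->
  (`|expo true h - expo true g| + `|c_count h - c_count g| <= 1)%R.
Proof.
have gen y : let x := pres_gen relations y in
    (`|expo true x| + `|expo true x + expo false x| <= 1)%R.
  by rewrite /= /expo !place_class // /height; case: y; rewrite /= ?big_seq1 ?big_nil.
move=> /adjacent_gen[x e]; have := gen x; rewrite /c_count.
by case: e => -> /=; rewrite !expoM; lia.
Qed.

Definition walk (p : nat -> G) : Prop := forall r, adjacent S2 (p r) (p r.+1).

Lemma walk_length p i j : walk p -> i <= j ->
  (`|expo true (p j) - expo true (p i)| + `|c_count (p j) - c_count (p i)| <= (j - i)%N%:Z)%R.
Proof.
move=> wp; elim: j => [|j IH]; first by rewrite leqn0 => /eqP->; lia.
rewrite leq_eqVlt => /predU1P[->|]; first by lia.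
by rewrite ltnS => ij; have := IH ij; have := expo_adjacent (wp j); lia.
Qed.

(** * Fellow travellers of a window *)

(** The ends of the window may lie at distance almost k from the vertices g and
    h that they follow, but these are at depth k in two components of the tree
    whose root is at s^-1 as seen from g. *)
Lemma window_across i s l k p g h a b : walk p -> reduced s -> a <= b ->
  dist S2_generates (p a) g < k -> dist S2_generates (p b) h < k ->
  k <= size s -> k <= size (place i s (g^-1 * h)) ->
  (bottom s == Some l) != (bottom (place i s (g^-1 * h)) == Some l) ->
  exists2 r, a <= r < b &
    across l (place i s (g^-1 * p r)) (place i s (g^-1 * p r.+1)).
Proof.
move=> wp rs ab da db ks kh bs.
apply: (@walk_across l (fun r => place i s (g^-1 * p r)) a b) => //.
  by move=> r; apply: place_tree_step => //; exact: adjacentMl.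
rewrite (dist_bottom rs db kh).
have e : place i s (g^-1 * g) = s by rewrite mulVg place1.
by rewrite (dist_bottom (z := g^-1) (i := i) rs da) ?e.
Qed.

Lemma flip_neq (l : letter gens) : (l == flip l) = false.
Proof. by apply/eqP => /(congr1 snd) /=; case: l.2. Qed.

Lemma reduced_nseq n l : reduced (nseq n l).
Proof.
case: n => // n; rewrite /reduced /=; elim: n => //= n ->.
by rewrite flip_neq.
Qed.

Lemma rcons_nseq (T : Type) n (x : T) : rcons (nseq n x) x = nseq n.+1 x.
Proof. by elim: n => //= n ->. Qed.

Lemma run_pop f l y n s :
  image f l = Some y -> run f (nseq n (flip y) ++ s) (nseq n l) = s.
Proof. by move=> fl; elim: n s => //= n IH s; rewrite /act fl /= eqxx IH. Qed.

Lemma run_push f l y n s : image f l = Some y ->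
  ohead s != Some (flip y) -> run f s (nseq n l) = nseq n y ++ s.
Proof.
move=> fl; elim: n s => //= n IH s hs.
have -> : act f s l = y :: s.
  rewrite /act fl; case: s hs => //= h s; case: (h =P flip y) => // ->.
  by rewrite eqxx.
rewrite IH /=; last by apply/eqP => -[e]; move/eqP: e; rewrite flip_neq.
by rewrite -cat1s catA cats1 rcons_nseq.
Qed.

Lemma bottom_last s l : bottom (s ++ [:: l]) = Some l.
Proof. by rewrite /bottom map_cat last_cat. Qed.

Lemma bottom_nseq n l : 0 < n -> bottom (nseq n l) = Some l.
Proof. by case: n => // n _; rewrite -rcons_nseq -cats1 bottom_last. Qed.

Lemma height_nseq n l : height (nseq n l) = (weight l *+ n)%R.
Proof.
rewrite /height; elim: n => [|n IH]; first by rewrite big_nil.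
by rewrite /= big_cons IH GRing.mulrS.
Qed.

Lemma across_height l s s' : across l s s' -> l.1 = Gt ->
  height s = 0%R /\ height s' = 0%R.
Proof.
case: l => x e /= + xt; rewrite {}xt /height.
by case=> -[-> ->]; rewrite big_nil big_seq1.
Qed.

Lemma across_empty l s s' : across l s s' -> s = [::] \/ s' = [::].
Proof. by case=> -[]; [left|right]. Qed.

(** Letters other than t act on an empty second coordinate by c or c^-1, so
    only an edge labelled t can cross a t-edge of the second tree. *)
Lemma across_t_left e s g h : reduced s -> adjacent S2 g h ->
  across (Gt, e) (place false s g) (place false s h) ->
  expo true h = expo true g.
Proof.
move=> rs; wlog [x ->] : g h / exists x, h = g * pres_gen relations x.
  move=> W /[dup] /adjacent_gen[x [-> gh | -> gh ac]]; first by apply: W => //; exists x.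
  apply/esym/W; first by exists x.
    by exists (pres_gen relations x); [case: x gh ac; rewrite !inE eqxx ?orbT|left].
  by case: ac => -[e1 e2]; [right|left].
move=> _; rewrite place_gen // expoM => ac.
have -> : x = Gt.
  have neq b : ((Gt, e) == (Gc, b) :> letter gens) = false by apply/eqP.
  by case: x ac => // -[] [->]; rewrite /act /image /= ?neq.
by rewrite /expo place_class //= /height big_nil; lia.
Qed.

(** The shapes refer to the exponent sum in x and y, which is 0 at both ends. *)
Definition peak x y e k : word gens := nseq k (x, true) ++ (Gt, e) :: nseq k (y, false).
Definition valley x y k : word gens := nseq k (x, false) ++ nseq k (y, true).
Definition dip x e k : word gens := nseq k (x, false) ++ (Gt, e) :: nseq k (x, true).

Definition horizontal (x : gens) : bool :=
  match x with Ga | Gb => true | _ => false end.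

Lemma window_visit s x k p g w a b : walk p -> reduced s -> a <= b ->
  dist S2_generates (p a) g < k ->
  dist S2_generates (p b) (g * pres_class relations w) < k ->
  k <= size s -> k <= size (run left_coord s w) ->
  (bottom s == Some x) != (bottom (run left_coord s w) == Some x) ->
  exists2 r, a <= r <= b & expo true (p r) = (expo true g - height s)%R.
Proof.
move=> wp rs ab da db ks kw bs.
have E : place true s (g^-1 * (g * pres_class relations w)) = run left_coord s w.
  by rewrite mulgA mulVg mul1g place_class.
have [||r /andP[ar rb] ac] := window_across (i := true) (l := x) wp rs ab da db ks.
- by rewrite E.
- by rewrite E.
have H q : place true s (g^-1 * q) = [::] -> expo true q = (expo true g - height s)%R.
  move=> /(congr1 height); rewrite height_place expoM expoV /height big_nil; lia.
case: (across_empty ac) => /H er; first by exists r; rewrite // ar ltnW.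
by exists r.+1; rewrite // rb leqW.
Qed.

Lemma window_t_edge s e k p g w a b : walk p -> reduced s -> a <= b ->
  dist S2_generates (p a) g < k ->
  dist S2_generates (p b) (g * pres_class relations w) < k ->
  k <= size s -> k <= size (run right_coord s w) ->
  (bottom s == Some (Gt, e)) != (bottom (run right_coord s w) == Some (Gt, e)) ->
  exists2 r, a <= r < b & [/\ expo true (p r.+1) = expo true (p r),
    expo false (p r) = (expo false g - height s)%R &
    expo false (p r.+1) = (expo false g - height s)%R].
Proof.
move=> wp rs ab da db ks kw bs.
have E : place false s (g^-1 * (g * pres_class relations w)) = run right_coord s w.
  by rewrite mulgA mulVg mul1g place_class.
have [||r arb ac] := window_across (i := false) (l := (Gt, e)) wp rs ab da db ks.
- by rewrite E.
- by rewrite E.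
exists r => //; have [h1 h2] := across_height ac erefl.
have H q : height (place false s (g^-1 * q)) = 0%R ->
    expo false q = (expo false g - height s)%R.
  by rewrite height_place expoM expoV; lia.
split; [|exact: H|exact: H].
have := across_t_left rs (adjacentMl g^-1 (wp r)) ac.
by rewrite !expoM; lia.
Qed.

Lemma horizontal_left x e : horizontal x -> image left_coord (x, e) = Some (x, e).
Proof. by case: x e => [] // []. Qed.

Lemma horizontal_right x e : horizontal x -> image right_coord (x, e) = Some (Gc, ~~ e).
Proof. by case: x e => [] // []. Qed.

Lemma horizontal_weight x e : horizontal x -> weight (x, e) = if e then 1%R else (-1)%R.
Proof. by case: x. Qed.

Lemma run_left_pass x y b d k : horizontal x -> horizontal y ->
  (x, b) != (y, ~~ d) ->
  run left_coord (nseq k (x, ~~ b)) (nseq k (x, b) ++ nseq k (y, d)) = nseq k (y, d).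
Proof.
move=> hx hy xy; rewrite run_cat -[nseq k (x, ~~ b)]cats0.
rewrite (run_pop (y := (x, b))) ?horizontal_left //.
rewrite (run_push (y := (y, d))) ?horizontal_left //.
by rewrite cats0.
Qed.

Lemma run_right_pass x y b e k : horizontal x -> horizontal y ->
  run right_coord (nseq k (Gc, b)) (nseq k (x, b) ++ (Gt, e) :: nseq k (y, ~~ b))
  = nseq k (Gc, b) ++ [:: (Gt, e)].
Proof.
move=> hx hy; rewrite run_cat -[nseq k (Gc, b)]cats0.
rewrite -{1}[b]negbK (run_pop (y := (Gc, ~~ b))) ?horizontal_right //.
have -> : run right_coord [::] ((Gt, e) :: nseq k (y, ~~ b)) =
          run right_coord [:: (Gt, e)] (nseq k (y, ~~ b)) by case: e.
by rewrite (run_push (y := (Gc, b))) ?horizontal_right ?negbK ?cats0 //; apply/eqP.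
Qed.

Lemma run_left_peak x y e k : horizontal x -> horizontal y -> x != y ->
  run left_coord (nseq k (x, false)) (peak x y e k) = nseq k (y, false).
Proof.
move=> hx hy xy; rewrite -(@run_left_pass x y true false k) //.
  by rewrite !run_cat.
by apply/eqP => -[/eqP]; rewrite (negbTE xy).
Qed.

(** In the first tree x^k followed by y^-k turns at a branch point, and in the
    second tree c^-k t^e c^k goes through the t-edge. *)
Lemma window_peak x y e k p g a b : horizontal x -> horizontal y -> x != y ->
  walk p -> a <= b -> 0 < k ->
  dist S2_generates (p a) g < k ->
  dist S2_generates (p b) (g * pres_class relations (peak x y e k)) < k ->
  (exists2 r, a <= r <= b & expo true (p r) = (expo true g + k%:Z)%R) /\
  (exists2 r, a <= r < b & [/\ expo true (p r.+1) = expo true (p r),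
    expo false (p r) = (expo false g - k%:Z)%R &
    expo false (p r.+1) = (expo false g - k%:Z)%R]).
Proof.
move=> hx hy xy wp ab k0 da db; split.
  have runE := @run_left_peak x y e k hx hy xy.
  have [|||r rab hr] :=
    window_visit (x := (x, false)) wp (reduced_nseq k (x, false)) ab da db.
  - by rewrite size_nseq.
  - by rewrite runE size_nseq.
  - rewrite runE !bottom_nseq // eqxx; apply/eqP => /esym/eqP[/eqP].
    by rewrite eq_sym (negbTE xy).
  exists r => //; rewrite hr height_nseq horizontal_weight //; lia.
have runE : run right_coord (nseq k (Gc, true)) (peak x y e k) =
    nseq k (Gc, true) ++ [:: (Gt, e)].
  exact: run_right_pass.
have [|||r rab hr] := window_t_edge (e := e) wp (reduced_nseq k (Gc, true)) ab da db.
- by rewrite size_nseq.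
- by rewrite runE size_cat size_nseq leq_addr.
- by rewrite runE bottom_last bottom_nseq // eqxx; apply/eqP => /eqP.
move: hr; rewrite height_nseq /weight /= => -[h1 h2 h3].
by exists r => //; split=> //; lia.
Qed.

(** Here the first coordinate goes back the way it came and gives no
    information: a follower may turn earlier, and only the t-edge is forced. *)
Lemma window_dip x e k p g a b : horizontal x ->
  walk p -> a <= b -> 0 < k ->
  dist S2_generates (p a) g < k ->
  dist S2_generates (p b) (g * pres_class relations (dip x e k)) < k ->
  exists2 r, a <= r < b & [/\ expo true (p r.+1) = expo true (p r),
    expo false (p r) = (expo false g + k%:Z)%R &
    expo false (p r.+1) = (expo false g + k%:Z)%R].
Proof.
move=> hx wp ab k0 da db.
have runE : run right_coord (nseq k (Gc, false)) (dip x e k) =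
    nseq k (Gc, false) ++ [:: (Gt, e)].
  exact: run_right_pass.
have [|||r rab hr] := window_t_edge (e := e) wp (reduced_nseq k (Gc, false)) ab da db.
- by rewrite size_nseq.
- by rewrite runE size_cat size_nseq leq_addr.
- by rewrite runE bottom_last bottom_nseq // eqxx; apply/eqP => /eqP.
move: hr; rewrite height_nseq /weight /= => -[h1 h2 h3].
by exists r => //; split=> //; lia.
Qed.

(** Here it is the second coordinate that backtracks. *)
Lemma window_valley x y k p g a b : horizontal x -> horizontal y -> x != y ->
  walk p -> a <= b -> 0 < k ->
  dist S2_generates (p a) g < k ->
  dist S2_generates (p b) (g * pres_class relations (valley x y k)) < k ->
  exists2 r, a <= r <= b & expo true (p r) = (expo true g - k%:Z)%R.
Proof.
move=> hx hy xy wp ab k0 da db.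
have runE : run left_coord (nseq k (x, true)) (valley x y k) = nseq k (y, true).
  rewrite -(@run_left_pass x y false true k) //.
  by apply/eqP => -[/eqP]; rewrite (negbTE xy).
have [|||r rab hr] :=
  window_visit (x := (x, true)) wp (reduced_nseq k (x, true)) ab da db.
- by rewrite size_nseq.
- by rewrite runE size_nseq.
- rewrite runE !bottom_nseq // eqxx; apply/eqP => /esym/eqP[/eqP].
  by rewrite eq_sym (negbTE xy).
exists r => //; rewrite hr height_nseq horizontal_weight //; lia.
Qed.

(** * Length of a passage between a dip and a valley *)

(** Let q be the exponent sum A at the t-edge of the peak, and p the one at the
    dip.  If the t-edge comes before the vertex with A = k, reaching it costs
    |q - p| + |q - p - 2k| >= 2k, and 2k further units of A separate the vertex
    from the valley.  Otherwise A goes from p to k, then to q, then to -k, and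
    the changes |k - p| + |q - k| + |q + k| of A together with the change
    |q - p - 2k| of A + C again add up to at least 4k. *)
Lemma dip_to_valley p k tP tX tT tY : walk p ->
  tP <= tX <= tY -> tP <= tT < tY ->
  expo false (p tP) = (k%:Z)%R ->
  expo true (p tX) = (k%:Z)%R ->
  expo true (p tT.+1) = expo true (p tT) ->
  expo false (p tT) = (- k%:Z)%R -> expo false (p tT.+1) = (- k%:Z)%R ->
  expo true (p tY) = (- k%:Z)%R ->
  4 * k + 1 <= tY - tP.
Proof.
move=> wp /andP[PX XY] /andP[PT TY] hP hX hT cT cT' hY.
case: (leqP tX tT) => [XT|TX].
  have := walk_length wp PX; have := walk_length wp XT; have := walk_length wp TY.
  by rewrite /c_count; lia.
have := walk_length wp PT; have := walk_length wp TX; have := walk_length wp XY.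
by rewrite /c_count; lia.
Qed.

Lemma valley_to_dip p k tY tX tT tP : walk p ->
  tY <= tX <= tP -> tY <= tT < tP ->
  expo true (p tY) = (- k%:Z)%R ->
  expo true (p tX) = (k%:Z)%R ->
  expo true (p tT.+1) = expo true (p tT) ->
  expo false (p tT) = (- k%:Z)%R -> expo false (p tT.+1) = (- k%:Z)%R ->
  expo false (p tP) = (k%:Z)%R ->
  4 * k + 1 <= tP - tY.
Proof.
move=> wp /andP[YX XP] /andP[YT TP] hY hX hT cT cT' hP.
case: (leqP tX tT) => [XT|TX].
  have := walk_length wp YX; have := walk_length wp XT; have := walk_length wp TP.
  by rewrite /c_count; lia.
have := walk_length wp YT; have := walk_length wp TX; have := walk_length wp XP.
by rewrite /c_count; lia.
Qed.

Lemma expo_peak i x y e k : horizontal x -> horizontal y ->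
  expo i (pres_class relations (peak x y e k)) = 0%R.
Proof.
move=> hx hy; rewrite expo_class run_cat height_run expo_nseq /= height_run height_act.
rewrite height_run expo_nseq.
by case: x hx => // _; case: y hy => // _; case: e; case: i;
  rewrite /act /image /height /= !(big_seq1, big_nil) /weight /=; lia.
Qed.

Lemma expo_dip i x e k : horizontal x ->
  expo i (pres_class relations (dip x e k)) = 0%R.
Proof.
move=> hx; rewrite expo_class run_cat height_run expo_nseq /= height_run height_act.
rewrite height_run expo_nseq.
by case: x hx => // _; case: e; case: i;
  rewrite /act /image /height /= !(big_seq1, big_nil) /weight /=; lia.
Qed.

Lemma expo_valley i x y k : horizontal x -> horizontal y ->
  expo i (pres_class relations (valley x y k)) = 0%R.
Proof.
move=> hx hy; rewrite expo_class run_cat height_run expo_nseq height_run expo_nseq.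
by case: x hx => // _; case: y hy => // _; case: i;
  rewrite /act /image /height /= !(big_seq1, big_nil) /weight /=; lia.
Qed.

(** * The loop *)

Definition zigzag k : seq (word gens) :=
  [:: peak Ga Gb true k; valley Gb Ga k; peak Ga Gb false k; dip Gb false k;
      peak Gb Ga true k; valley Ga Gb k; peak Gb Ga false k; dip Ga true k].

Lemma expo_zigzag i k :
  all (fun w => expo i (pres_class relations w) == 0%R) (zigzag k).
Proof.
rewrite /zigzag /= (expo_peak i true k (x := Ga) (y := Gb)) //.
rewrite (expo_peak i false k (x := Ga) (y := Gb)) //.
rewrite (expo_peak i true k (x := Gb) (y := Ga)) //.
rewrite (expo_peak i false k (x := Gb) (y := Ga)) //.
rewrite (expo_valley i k (x := Ga) (y := Gb)) //.
rewrite (expo_valley i k (x := Gb) (y := Ga)) //.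
by rewrite (expo_dip i true k (x := Ga)) // (expo_dip i false k (x := Gb)).
Qed.

Lemma pres_class_nseq n x e : pres_class relations (nseq n (x, e)) =
  (if e then pres_gen relations x else (pres_gen relations x)^-1) ^+ n.
Proof.
elim: n => [|n IH]; first by rewrite expg0.
by rewrite /= -cat1s pres_class_cat IH expgS; case: e {IH}; rewrite // -pres_class_winv.
Qed.

Lemma pres_class_cons x e w : pres_class relations ((x, e) :: w) =
  (if e then pres_gen relations x else (pres_gen relations x)^-1) *
  pres_class relations w.
Proof. by rewrite -cat1s pres_class_cat; case: e; rewrite // -pres_class_winv. Qed.

(** The letters t come in pairs around y^-2 x^2, its inverse, and the square of
    y^2 x^-2; t commutes with all of them, so that these pairs cancel. *)
Lemma commutator_word (H : groupType) (x y t : H) :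
  commute t ((y * y)^-1 * (x * x)) -> commute t ((y * y) * (x * x)^-1) ->
  x * t * y^-1 * y^-1 * x * x * t^-1 * y^-1 * y^-1 * t^-1 * y * y * t
    * x^-1 * x^-1 * y * y * t^-1 * x^-1 * x^-1 * t * x = 1.
Proof.
set U := _ * _ => tU; set V := _ * _ => tV.
have -> : x * t * y^-1 * y^-1 * x * x * t^-1 * y^-1 * y^-1 * t^-1 * y * y * t
    * x^-1 * x^-1 * y * y * t^-1 * x^-1 * x^-1 * t * x =
    x * (t * U * t^-1) * (y * y)^-1 *
    (t^-1 * ((y * y) * (t * U^-1 * t^-1) * (x * x)^-1 * t)) * x.
  by rewrite /U !invgM !invgK !mulgA.
have -> : t * U * t^-1 = U by rewrite tU mulgK.
have -> : t * U^-1 * t^-1 = U^-1 by rewrite (commuteV tU) mulgK.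
have -> : y * y * U^-1 * (x * x)^-1 = V * V by rewrite /U /V !invgM !invgK !mulgA.
have -> : t^-1 * (V * V * t) = V * V.
  by rewrite -(commuteM tV tV) mulgA mulVg mul1g.
by rewrite /U /V !invgM !mulgA !(mulgK, mulgVK, mulgV, mul1g).
Qed.

(** With n = 2k, b^-n a^n = (bc)^-n (ac)^n and b^n a^-n = (bc)^n (ac)^-n commute
    with t, because c commutes with a and b. *)
Lemma zigzag_closed k : pres_class relations (flatten (zigzag k)) = 1.
Proof.
rewrite /= !(pres_class_cat, pres_class_nseq, pres_class_cons, cats0,
  cat_cons).
set a := pres_gen _ Ga; set b := pres_gen _ Gb; set t := pres_gen _ Gt.
pose c := pres_gen relations Gc.
have rel r : r \in relations -> word_eval (pres_gen relations) r.1 =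
    word_eval (pres_gen relations) r.2.
  by move=> /pres_class_rel; rewrite !pres_class_eval.
have ac : commute a c.
  have := rel (pos [:: Ga; Gc], pos [:: Gc; Ga]); rewrite !inE eqxx /= => /(_ isT).
  by rewrite /word_eval !big_cons big_nil !mulg1.
have bc : commute b c.
  have := rel (pos [:: Gb; Gc], pos [:: Gc; Gb]).
  rewrite !inE eqxx ?orbT /= => /(_ isT).
  by rewrite /word_eval !big_cons big_nil !mulg1.
have tac : commute t (a * c).
  have := rel (pos [:: Ga; Gc; Gt], pos [:: Gt; Ga; Gc]).
  rewrite !inE eqxx ?orbT /= => /(_ isT).
  by rewrite /word_eval !big_cons big_nil !mulg1 mulgA => /commute_sym.
have tbc : commute t (b * c).
  have := rel (pos [:: Gb; Gc; Gt], pos [:: Gt; Gb; Gc]).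
  rewrite !inE eqxx ?orbT /= => /(_ isT).
  by rewrite /word_eval !big_cons big_nil !mulg1 mulgA => /commute_sym.
have tA : commute t (a ^+ (k + k) * c ^+ (k + k)) by rewrite -expgMn //; exact: commuteX.
have tB : commute t (b ^+ (k + k) * c ^+ (k + k)) by rewrite -expgMn //; exact: commuteX.
have cA : commute (a ^+ (k + k)) (c ^+ (k + k)) by exact: commuteX2.
have cB : commute (b ^+ (k + k)) (c ^+ (k + k)) by exact: commuteX2.
rewrite -(@commutator_word _ (a ^+ k) (b ^+ k) t) -?expgnDr ?expVgn ?mulgA //.
  have -> : (b ^+ (k + k))^-1 * a ^+ (k + k) =
      (b ^+ (k + k) * c ^+ (k + k))^-1 * (a ^+ (k + k) * c ^+ (k + k)).
    by rewrite cA cB invgM mulgA mulgVK.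
  exact: commuteM (commuteV tB) tA.
have -> : b ^+ (k + k) * (a ^+ (k + k))^-1 =
    (b ^+ (k + k) * c ^+ (k + k)) * (a ^+ (k + k) * c ^+ (k + k))^-1.
  by rewrite invgM mulgA mulgK.
exact: commuteM tB (commuteV tA).
Qed.

Theorem theorem4p3 : ~ @loop_shortening G S2 S2_generates.
Proof.
move=> [k shorten].
pose W := flatten (zigzag k).
pose v j := pres_class relations (take j W).
have sW : size W = 16 * k + 6.
  by rewrite /W /= !size_cat /= !size_nseq; lia.
have v_loop : loop S2 (size W) v.
  split=> [|j jW]; first by rewrite /v take_size take0 zigzag_closed.
  rewrite /v (take_nth (Ga, true)) // -cats1 pres_class_cat.
  case: (nth _ _ _) => x e.
  have xS : pres_gen relations x \in S2 by rewrite !inE; case: x; rewrite eqxx ?orbT.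
  exists (pres_gen relations x) => //; case: e; [left|right] => //.
  by rewrite -[[:: _]]/(winv [:: (x, true)]) pres_class_winv mulgVK.
have [|m [u [mW [um u_adj] u_near u_end]]] := shorten _ _ _ v_loop.
  by rewrite sW; lia.
have k0 : 0 < k by exact: leq_ltn_trans (u_near 0 (leq0n m)).
have near P : prefix P W ->
    dist S2_generates (u (minn (size P) m)) (pres_class relations P) < k.
  move=> /prefixP[Q WPQ].
  have -> : pres_class relations P = v (size P) by rewrite /v WPQ take_size_cat.
  have [Pm|mP] := leqP (size P) m; first exact: u_near.
  by apply: u_end; rewrite (ltnW mP) WPQ size_cat leq_addr.
pose pre i := flatten (take i (zigzag k)); pose T i := minn (size (pre i)) m.
have preS i : i < 8 -> pre i.+1 = pre i ++ nth [::] (zigzag k) i.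
  by move=> i8; rewrite /pre (take_nth [::]) // flatten_rcons.
have dpre i : dist S2_generates (u (T i)) (pres_class relations (pre i)) < k.
  apply: near; suff -> : W = pre i ++ flatten (drop i (zigzag k)) by exact: prefix_prefix.
  by rewrite -flatten_cat cat_take_drop.
have dpreS i : i < 8 -> dist S2_generates (u (T i.+1))
    (pres_class relations (pre i) * pres_class relations (nth [::] (zigzag k) i)) < k.
  by move=> /preS e; rewrite -pres_class_cat -e.
have TS i : i < 8 -> T i <= T i.+1.
  by move=> /preS e; rewrite /T e size_cat; lia.
have expo0 j i : expo j (pres_class relations (pre i)) = 0%R.
  have [i8|i8] := leqP i 8; last first.
    by rewrite /pre take_oversize ?(ltnW i8) // zigzag_closed expo1.
  elim: i i8 => [|i IH] i8.
    by rewrite /pre take0 pres_class1 expo1.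
  rewrite (preS _ i8) pres_class_cat expoM (IH (ltnW i8)) GRing.add0r.
  exact/eqP/(all_nthP [::] (expo_zigzag j k)).
have [m0|m0] := posnP m.
  (* A constant loop would be close to both ends of the first peak, which lie
     in different components. *)
  have := near (peak Ga Gb true k) (prefix_prefix _ _).
  have := near [::] (prefix0s _); rewrite m0 !minn0 => d0 d1.
  have rs := reduced_nseq k (Ga, false).
  have := dist_bottom (i := true) (z := 1) rs d1.
  have := dist_bottom (i := true) (z := 1) rs d0.
  rewrite !mul1g !place_class // /coord run_left_peak //; last by apply/eqP.
  rewrite [run _ _ [::]]/= !size_nseq !bottom_nseq // => /(_ (leqnn k)) ->.
  by move=> /(_ (leqnn k)).
(* Going around u periodically lets the last passage run across the base
   point. *)
pose p r := u (r %% m).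
have pE r : r <= m -> p r = u r.
  by rewrite leq_eqVlt /p => /predU1P[->|/modn_small->]; rewrite ?modnn.
have wp : walk p.
  move=> r; rewrite /p; have rm : r %% m < m by rewrite ltn_mod.
  have := u_adj _ rm; congr (adjacent _ _ _).
  rewrite -[r.+1]addn1 -modnDml addn1.
  by move: rm; rewrite leq_eqVlt => /predU1P[->|/modn_small->]; rewrite ?modnn.
have pper r : p (r + m) = p r by rewrite /p modnDr.
have Tm i : T i <= m by exact: geq_minr.
have dp i : dist S2_generates (p (T i)) (pres_class relations (pre i)) < k by rewrite pE.
have dpS i : i < 8 -> dist S2_generates (p (T i.+1))
    (pres_class relations (pre i) * pres_class relations (nth [::] (zigzag k) i)) < k.
  by rewrite pE //; exact: dpreS.
have neqAB : Ga != Gb by apply/eqP.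
have neqBA : Gb != Ga by apply/eqP.
have [[x1 x1T x1A] [c1 c1T [c1A c1C c1C']]] :=
  window_peak (x := Ga) (y := Gb) isT isT neqAB wp (TS 0 isT) k0 (dp 0) (dpS 0 isT).
have [y2 y2T y2A] :=
  window_valley (x := Gb) (y := Ga) isT isT neqBA wp (TS 1%N isT) k0
    (dp 1%N) (dpS 1%N isT).
have [[x3 x3T x3A] [c3 c3T [c3A c3C c3C']]] :=
  window_peak (x := Ga) (y := Gb) isT isT neqAB wp (TS 2 isT) k0 (dp 2) (dpS 2 isT).
have [c4 c4T [c4A c4C c4C']] :=
  window_dip (x := Gb) isT wp (TS 3 isT) k0 (dp 3) (dpS 3 isT).
have [[x5 x5T x5A] [c5 c5T [c5A c5C c5C']]] :=
  window_peak (x := Gb) (y := Ga) isT isT neqBA wp (TS 4 isT) k0 (dp 4) (dpS 4 isT).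
have [y6 y6T y6A] :=
  window_valley (x := Ga) (y := Gb) isT isT neqAB wp (TS 5 isT) k0 (dp 5) (dpS 5 isT).
have [[x7 x7T x7A] [c7 c7T [c7A c7C c7C']]] :=
  window_peak (x := Gb) (y := Ga) isT isT neqBA wp (TS 6 isT) k0 (dp 6) (dpS 6 isT).
have [c8 c8T [c8A c8C c8C']] :=
  window_dip (x := Ga) isT wp (TS 7 isT) k0 (dp 7) (dpS 7 isT).
have T0 : T 0 = 0 by exact: min0n.
have T8 := Tm 8.
rewrite !expo0 !GRing.add0r in x1A c1C c1C' y2A x3A c3C c3C' c4C c4C'.
rewrite !expo0 !GRing.add0r in x5A c5C c5C' y6A x7A c7C c7C' c8C c8C'.
(* The four passages are consecutive, up to the t-edges of the two dips. *)
have e23 : 4 * k + 1 <= c4 - y2.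
  by apply: (valley_to_dip wp (tX := x3) (tT := c3)) => //; lia.
have e45 : 4 * k + 1 <= y6 - c4.+1.
  by apply: (dip_to_valley wp (tX := x5) (tT := c5)) => //; lia.
have e67 : 4 * k + 1 <= c8 - y6.
  by apply: (valley_to_dip wp (tX := x7) (tT := c7)) => //; lia.
have e81 : 4 * k + 1 <= (y2 + m) - c8.+1.
  apply: (dip_to_valley wp (tX := x1 + m) (tT := c1 + m)); rewrite -?addSn ?pper //; lia.
by move: mW; rewrite sW; lia.
Qed.
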